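(* There is an absolute constant $c>0$ such that the following holds. Let $R$ be an $n\times n$ irreducible, $\frac12$-lazy nonnegative matrix with PF eigenvalue $1$ and positive left and right eigenvectors $u,v$ normalized so that $\langle u,v\rangle=1$, and let $\kappa(R)=\min_i u_iv_i$. Then for every $0<\epsilon<1$, \[ \tau_\epsilon(R)\le c\cdot\frac{n+\ln\!\left(\frac{1}{\epsilon\cdot\kappa(R)}\right)}{\Delta(R)}. \]
   Context: $R$ is $\frac12$-lazy if $R_{i,i}\ge\frac12$ for all $i$. Irreducible: for all $s,t$ there is $k>0$ with $(R^k)_{s,t}>0$; then the PF eigenvalue is simple with positive eigenvectors. $D_u$ is the diagonal matrix with $u$ on the diagonal. The mixing time $\tau_\epsilon(R)$ is the smallest nonnegative integer $\tau$ such that $\|D_u(R^\tau-v u^T)x\|_1\le\epsilon$ for every real vector $x$ with $\|D_ux\|_1=1$. The spectral gap is $\Delta(R)=1-\operatorname{Re}\lambda_2(R)$, where the eigenvalues are ordered $1=\lambda_1>\operatorname{Re}\lambda_2\ge\cdots\ge\operatorname{Re}\lambda_n$. *)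

(* Defs.v *)
From HB Require Import structures.
From mathcomp Require Import all_boot all_order all_algebra.
From mathcomp Require Import boolp classical_sets reals.
From mathcomp Require Import Rstruct exp.
From mathcomp Require Import complex.
From Stdlib Require Rdefinitions.
Set Implicit Arguments. Unset Strict Implicit. Unset Printing Implicit Defensive.
Import Order.TTheory GRing.Theory Num.Theory.
Local Open Scope ring_scope.

Notation R := Rdefinitions.R.

Section Defs.
Variable n : nat.
Implicit Types (A : 'M[R]_n) (u v x : 'cV[R]_n).

Definition nonneg_mx A := forall i j, 0 <= A i j.

Definition irreducible_mx A :=
  forall s t : 'I_n, exists k : nat, (0 < k)%N /\ 0 < (A ^+ k) s t.

Definition half_lazy A := forall i, 1 / 2%:R <= A i i.

Definition Dmx u : 'M[R]_n := diag_mx u^T.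

Definition l1norm x : R := \sum_i `|x i 0|.

Definition mixes A u v (eps : R) (tau : nat) : Prop :=
  forall x : 'cV[R]_n, l1norm (Dmx u *m x) = 1 ->
    l1norm (Dmx u *m ((A ^+ tau - v *m u^T) *m x)) <= eps.

(* mixing time: the smallest tau satisfying the mixing condition
   (defaults to 0 if no such tau exists; the theorem asserts existence). *)
Definition mixing_time A u v (eps : R) : nat :=
  match pselect (exists tau, `[< mixes A u v eps tau >]) with
  | left h => ex_minn h
  | right _ => 0%N
  end.

Definition char_polyC A : {poly complex R} :=
  char_poly (map_mx (fun r : R => Complex r 0) A).

(* The multiset of eigenvalues lambda_2,...,lambda_n (all eigenvalues
   with multiplicity, with one copy of the eigenvalue 1 removed):
   z is in it iff z is a root of the char. polynomial and either z <> 1,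
   or z = 1 has multiplicity >= 2. *)
Definition other_eigenvalue A (z : complex R) : Prop :=
  root (char_polyC A) z /\ (z <> 1 \/ (1 < mup (1 : complex R) (char_polyC A))%N).

(* Re lambda_2 = max of Re over the remaining eigenvalues (a finite set);
   spectral gap Delta = 1 - Re lambda_2. *)
Definition spectral_gap A : R :=
  1 - sup [set complex.Re z | z in other_eigenvalue A].

End Defs.

Definition kappa (n : nat) (u v : 'cV[R]_n.+1) : R :=
  \big[Num.min/(u ord0 0 * v ord0 0)]_(i < n.+1) (u i 0 * v i 0).

(* Main.v *)
(* With w_i = sqrt (u_i v_i), conjugating A by the diagonal matrix sqrt (u_i / v_i)
   gives a matrix E that fixes w on both sides; by Schur's test E and 2 E - 1 are
   contractions of l^2.  Write E = P^* T P with P unitary and T triangular.  Every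
   eigenvalue z satisfies |2 z - 1| <= 1, that is |z|^2 <= Re z, and by irreducibility
   exactly one diagonal entry of T is 1; deleting it replaces T^k by the image of
   A^k - v u^T, and the other diagonal entries satisfy |z|^2 <= 1 - g where g is
   the gap.

   As T is a triangular contraction, |T_ij| <= d_i d_j off the diagonal, where
   d_i = sqrt (1 - |T_ii|^2), and |T_ii| + d_i^2 / 4 <= s := 1 - g / 4.  Hence the
   weights 5^i / d_i form a supersolution of |T| for the eigenvalue s, for the rows
   as well as (with 5^-i / d_i) for the columns; multiplying the two resulting
   bounds cancels the d_i, and |(T^k)_ij| <= 5^n s^k.  It is this cancellation that
   avoids a factor log (1 / g). *)

Require Import Defs.
From HB Require Import structures.
From mathcomp Require Import all_boot all_order all_algebra.
From mathcomp Require Import boolp classical_sets reals.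
From mathcomp Require Import Rstruct exp.
From mathcomp Require Import complex.
From mathcomp Require Import sequences zify ring lra.
Set Implicit Arguments. Unset Strict Implicit. Unset Printing Implicit Defensive.
Import Order.TTheory GRing.Theory Num.Theory.
Local Open Scope ring_scope.
Local Open Scope sesquilinear_scope.
Import ComplexField.Normc.

(** * The modulus on the complex extension of a real closed field *)

Section ComplexNorm.
Variable F : rcfType.
Implicit Types z : F[i].

Lemma normc_ge0 z : 0 <= normc z.
Proof. by case: z => a b; apply: sqrtr_ge0. Qed.

Lemma sqr_normc_ReIm z : normc z ^+ 2 = complex.Re z ^+ 2 + complex.Im z ^+ 2.
Proof. by case: z => a b /=; rewrite sqr_sqrtr // addr_ge0 // sqr_ge0. Qed.

Lemma normc_real (x : F) : normc x%:C%C = `|x|.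
Proof. by rewrite /= expr0n /= addr0 sqrtr_sqr. Qed.

Lemma norm_normc z : `|z| = (normc z)%:C%C.
Proof. by rewrite normc_def; case: z. Qed.

Lemma normc_conj z : normc z^* = normc z.
Proof. by apply: complexI; rewrite -!norm_normc norm_conjC. Qed.

Lemma conj_real_complex (x : F) : (x%:C%C)^* = x%:C%C.
Proof. by apply/CrealP; rewrite complex_real. Qed.

Lemma conj_mul_real z (x : F) : (z * x%:C%C)^* = z^* * x%:C%C.
Proof. by rewrite -[in RHS]conj_real_complex -rmorphM. Qed.

Lemma mul_conjC_normc z : z * z^* = (normc z ^+ 2)%:C%C.
Proof. by rewrite -normCK norm_normc rmorphXn. Qed.

Lemma normc_eq0 z : (normc z == 0) = (z == 0).
Proof.
by apply/eqP/eqP => [/eq0_normc //|->]; rewrite normc0.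
Qed.

Lemma normc_sum (I : Type) (r : seq I) (P : pred I) (f : I -> F[i]) :
  normc (\sum_(i <- r | P i) f i) <= \sum_(i <- r | P i) normc (f i).
Proof.
elim/big_ind2: _ => [|x x' y y' hx hy|//]; first by rewrite normc0.
exact: le_trans (le_normcD _ _) (lerD hx hy).
Qed.

End ComplexNorm.

(** * Powers of triangular matrices, bounded through supersolutions *)

Section TriangularPowers.
Variables (F : rcfType) (n : nat).
Implicit Types (T : 'M[F[i]]_n.+1) (d y : 'I_n.+1 -> F).

(** Induction on $k$ with the column $j$ fixed: expand $T^{k+1}=T\,T^k$, bound each
    $|(T^k)_{lj}|y_j$ by $s^ky_l$, and use the supersolution $y$ once more. *)
Lemma normc_expmx_le T y (s : F) : 0 <= s -> (forall i, 0 <= y i) ->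
  (forall i, \sum_j normc (T i j) * y j <= s * y i) ->
  forall k i j, normc ((T ^+ k) i j) * y j <= s ^+ k * y i.
Proof.
move=> s0 y0 sup; elim=> [|k IH] i j.
  rewrite !expr0 mul1r mxE; case: eqP => [->|_]; first by rewrite normc1 mul1r.
  by rewrite normc0 mul0r.
rewrite exprS mxE; apply: (@le_trans _ _ (\sum_l normc (T i l) * (s ^+ k * y l))).
  apply: (@le_trans _ _ ((\sum_l normc (T i l * (T ^+ k) l j)) * y j)).
    by rewrite ler_wpM2r ?normc_sum.
  rewrite mulr_suml; apply: ler_sum => l _.
  by rewrite normcM -mulrA ler_wpM2l // normc_ge0.
under eq_bigr do rewrite mulrCA.
by rewrite -mulr_sumr exprSr -mulrA ler_wpM2l // exprn_ge0.
Qed.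

Lemma trmx_exp T k : (T ^+ k)^T = T^T ^+ k.
Proof.
by elim: k => [|k IH]; rewrite ?expr0 ?trmx1 // exprS exprSr -!mulmxE trmx_mul IH.
Qed.

(** A geometric sum. The base 5 produces the factor $\frac14$ that multiplies $d_i^2$ in
    [trig_expmx_le]. *)
Lemma sum_expr5_lt m (i : 'I_m) : \sum_(j < m | (j < i)%N) 5%:R ^+ j <= 5%:R ^+ i / 4%:R :> F.
Proof.
rewrite (eq_bigl (fun j : 'I_m => true && (j < i)%N)) //.
rewrite -(big_ord_widen_cond m xpredT (fun j => 5%:R ^+ j)) ?(ltnW (ltn_ord i)) //.
elim: (nat_of_ord i) => [|k IH]; first by rewrite big_ord0 expr0 mul1r invr_ge0 ler0n.
rewrite big_ord_recr /= exprSr.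
have : 0 <= 5%:R ^+ k :> F by rewrite exprn_ge0 ?ler0n.
move: IH; set S := \sum_(_ < _) _; set q := _ ^+ k => *; lra.
Qed.

Lemma sum_expr5_gt m (i : 'I_m.+1) :
  \sum_(j < m.+1 | (i < j)%N) 5%:R ^+ (m - j) <= 5%:R ^+ (m - i) / 4%:R :> F.
Proof.
have := sum_expr5_lt (rev_ord i); rewrite /= subSS.
congr (_ <= _); rewrite (reindex_inj rev_ord_inj) /=.
apply: eq_big => j; last by rewrite subSS.
by have := ltn_ord i; have := ltn_ord j; rewrite !subSS; lia.
Qed.

Lemma trig_expmx_le T d (s : F) :
  is_trig_mx T -> (forall i, 0 < d i) ->
  (forall i j, i != j -> normc (T i j) <= d i * d j) ->
  (forall i, normc (T i i) + d i ^+ 2 / 4%:R <= s) ->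
  forall k i j, normc ((T ^+ k) i j) <= 5%:R ^+ n * s ^+ k.
Proof.
move=> /is_trig_mxP Ttrig d0 Tod Td k i j.
have s0 : 0 <= s.
  by apply: le_trans (Td i); rewrite addr_ge0 ?normc_ge0 // divr_ge0 ?sqr_ge0 ?ler0n.
(* This covers $T$ and $T^T$ at once; [r] is the strict order that carries the nonzero off-diagonal
   entries. The weights $e_m/d_m$ cancel $d_m$ in $|M_{lm}|\le d_ld_m$, so the off-diagonal part of
   row $l$ is at most $d_l\sum_m e_m\le \frac{d_l^2}{4}\cdot\frac{e_l}{d_l}$. *)
have row_le (M : 'M[F[i]]_n.+1) (e : 'I_n.+1 -> F) (r : rel 'I_n.+1) :
    (forall l, 0 <= e l) ->
    (forall l, \sum_(m | r l m) e m <= e l / 4%:R) ->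
    (forall l, ~~ r l l) ->
    (forall l m, l != m -> ~~ r l m -> M l m = 0) ->
    (forall l m, r l m -> normc (M l m) <= d l * d m) ->
    (forall l, normc (M l l) + d l ^+ 2 / 4%:R <= s) ->
    forall l, \sum_m normc (M l m) * (e m / d m) <= s * (e l / d l).
  move=> e0 se rirr M0 Mod Md l; rewrite (bigD1 l) //= (bigID (r l)) /=.
  rewrite [X in _ + (_ + X)]big1 ?addr0; last first.
    by move=> m /andP[ml nr]; rewrite M0 1?eq_sym // normc0 mul0r.
  have -> : s * (e l / d l) = (s * d l ^- 2) * (d l * e l).
    by field; rewrite gt_eqF.
  apply: (@le_trans _ _ ((normc (M l l) + d l ^+ 2 / 4%:R) * d l ^- 2 * (d l * e l))).
    rewrite mulrDl mulrDl.
    have -> : normc (M l l) * d l ^- 2 * (d l * e l) = normc (M l l) * (e l / d l).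
      by field; rewrite gt_eqF.
    rewrite lerD2l.
    have -> : d l ^+ 2 / 4%:R / d l ^+ 2 * (d l * e l) = d l * (e l / 4%:R).
      by field; rewrite gt_eqF.
    apply: le_trans (ler_wpM2l (ltW (d0 l)) (se l)); rewrite mulr_sumr.
    rewrite [X in X <= _](eq_bigl (r l)); last first.
      by move=> m; case: eqP => [->|//]; rewrite (negbTE (rirr l)).
    apply: ler_sum => m rm.
    apply: (@le_trans _ _ (d l * d m * (e m / d m))).
      by rewrite ler_wpM2r ?Mod // divr_ge0 // ltW.
    by rewrite le_eqVlt; apply/orP; left; apply/eqP; field; rewrite gt_eqF.
  by rewrite ler_wpM2r ?ler_wpM2r ?invr_ge0 ?exprn_ge0 ?mulr_ge0 // ltW.
have e0 (m : nat) : 0 <= 5%:R ^+ m :> F by rewrite exprn_ge0 ?ler0n.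
have yd0 (m : nat) l : 0 <= 5%:R ^+ m / d l by rewrite divr_ge0 // ltW.
have Hr := @normc_expmx_le T (fun l => 5%:R ^+ l / d l) s s0 (fun l => yd0 l l)
  (row_le T (fun l => 5%:R ^+ l) (fun l m => (m < l)%N) (fun l => e0 l)
    (@sum_expr5_lt _) _ _ _ Td) k i j.
have Hc := @normc_expmx_le T^T (fun l => 5%:R ^+ (n - l) / d l) s s0 (fun l => yd0 _ l)
  (row_le T^T (fun l => 5%:R ^+ (n - l)) (fun l m => (l < m)%N) (fun l => e0 _)
    (@sum_expr5_gt _) _ _ _ _) k j i.
have {}Hr : normc ((T ^+ k) i j) * (5%:R ^+ j / d j) <= s ^+ k * (5%:R ^+ i / d i).
  apply: Hr => [l|l m lm|l m lm]; first by rewrite ltnn.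
    by move=> nlt; apply: Ttrig; move: lm nlt; rewrite -val_eqE /=; lia.
  by apply: Tod; rewrite -val_eqE neq_ltn lm orbT.
have {}Hc : normc ((T ^+ k) i j) * (5%:R ^+ (n - i) / d i)
    <= s ^+ k * (5%:R ^+ (n - j) / d j).
  have -> : (T ^+ k) i j = (T^T ^+ k) j i by rewrite -trmx_exp mxE.
  apply: Hc => [l|l m lm|l m lm|l]; rewrite ?ltnn // !mxE //.
    by move=> nlt; apply: Ttrig; move: lm nlt; rewrite -val_eqE /=; lia.
  by rewrite mulrC; apply: Tod; rewrite -val_eqE neq_ltn lm orbT.
move: Hr Hc; set X := normc _ => Hr Hc.
have X0 : 0 <= X by apply: normc_ge0.
rewrite -ler_sqr ?nnegrE ?mulr_ge0 ?exprn_ge0 ?ler0n //.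
have ge1 (m : nat) : 1 <= 5%:R ^+ m :> F by rewrite exprn_ege1 ?ler1n.
have Ni : 5%:R ^+ n = 5%:R ^+ i * 5%:R ^+ (n - i) :> F by rewrite -exprD subnKC // -ltnS.
have Nj : 5%:R ^+ n = 5%:R ^+ j * 5%:R ^+ (n - j) :> F by rewrite -exprD subnKC // -ltnS.
(* In the product of the row bound and the column bound both $d_i$ and $d_j$ cancel. *)
have XX : X ^+ 2 * (5%:R ^+ j * 5%:R ^+ (n - i)) <=
    (s ^+ k) ^+ 2 * (5%:R ^+ i * 5%:R ^+ (n - j)).
  have := ler_pM (mulr_ge0 X0 (yd0 _ _)) (mulr_ge0 X0 (yd0 _ _)) Hr Hc.
  rewrite -(ler_pM2r (mulr_gt0 (d0 i) (d0 j))); congr (_ <= _); field; rewrite ?gt_eqF //;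
  by apply/andP; rewrite !gt_eqF.
(* One more factor $5^j5^{n-i}\ge1$ completes the powers on the right of [XX] to $5^n\cdot5^n$. *)
apply: (@le_trans _ _ (X ^+ 2 * (5%:R ^+ j * 5%:R ^+ (n - i)) ^+ 2)).
  by rewrite ler_peMr ?sqr_ge0 // exprn_ege1 // mulr_ege1.
rewrite [X in _ * X]expr2 mulrA.
apply: le_trans (ler_wpM2r (mulr_ge0 (e0 j) (e0 (n - i)%N)) XX) _.
rewrite [in leRHS]expr2 {1}Ni Nj le_eqVlt; apply/orP; left; apply/eqP; ring.
Qed.

End TriangularPowers.

(** * Contractions of $\ell^2$ and their entries *)

Section Contractions.
Variables (F : rcfType) (n : nat).
Implicit Types (x : 'cV[F[i]]_n) (T P : 'M[F[i]]_n).

Definition l2sq x : F := \sum_i normc (x i 0) ^+ 2.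

Definition contraction T := forall x, l2sq (T *m x) <= l2sq x.

Lemma l2sqE x : (l2sq x)%:C%C = (x^t* *m x) 0 0.
Proof.
rewrite rmorph_sum mxE; apply: eq_bigr => i _.
by rewrite !mxE mulrC mul_conjC_normc.
Qed.

Lemma l2sq_unitary P x : P \is unitarymx -> l2sq (P *m x) = l2sq x.
Proof.
move=> /unitarymxP/mulmx1C PP; apply: (@complexI F).
by rewrite !l2sqE trmx_mul map_mxM -mulmxA [P^t* *m _]mulmxA PP mul1mx.
Qed.

Lemma contraction_unitary P T :
  P \is unitarymx -> contraction T -> contraction (P *m T *m P^t*).
Proof.
move=> PU Tc x; have PtU : P^t* \is unitarymx by rewrite trmxC_unitary.
by rewrite -!mulmxA (l2sq_unitary _ PU) -(l2sq_unitary x PtU).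
Qed.

Lemma contraction_pair T i j (a b : F[i]) : contraction T -> i != j ->
  normc (T i i * a + T i j * b) ^+ 2 + normc (T j i * a + T j j * b) ^+ 2
    <= normc a ^+ 2 + normc b ^+ 2.
Proof.
move=> Tc ij; have := Tc (a *: delta_mx i 0 + b *: delta_mx j 0).
have ji : (j == i) = false by rewrite eq_sym (negbTE ij).
have Tx l : (T *m (a *: delta_mx i 0 + b *: delta_mx j 0 : 'cV_n)) l 0 = T l i * a + T l j * b.
  by rewrite mulmxDr -!scalemxAr -!colE !mxE ![_ * T _ _]mulrC.
rewrite /l2sq (bigD1 i) //= (bigD1 j) ?ji //= !Tx.
rewrite [in leRHS](bigD1 i) //= [in leRHS](bigD1 j) ?ji //= [X in _ <= _ + (_ + X)]big1.
  rewrite !mxE !eqxx ji (negbTE ij) /= !mulr0 !mulr1 addr0 add0r addr0.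
  by apply: le_trans; rewrite addrA lerDl sumr_ge0 // => l _; rewrite sqr_ge0.
move=> l /andP[li lj].
by apply/eqP; rewrite !mxE (negbTE li) (negbTE lj) /= !mulr0 addr0 sqrf_eq0 normc_eq0.
Qed.

Lemma contraction_diag T i : contraction T -> normc (T i i) ^+ 2 <= 1.
Proof.
move=> Tc; have := Tc (delta_mx i 0); rewrite -colE /l2sq.
rewrite (bigD1 i) //= [in leRHS](bigD1 i) //= !mxE !eqxx normc1 expr1n.
rewrite [X in _ <= 1 + X]big1 ?addr0; last first.
  by move=> l li; apply/eqP; rewrite mxE (negbTE li) sqrf_eq0 normc_eq0.
by apply: le_trans; rewrite lerDl sumr_ge0 // => l _; rewrite sqr_ge0.
Qed.

(* Positivity of the 2x2 determinant of 1 - M^* M, where M is the compression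
   of T to the coordinates i and j. *)
Lemma contraction_offdiag T i j : contraction T -> i != j -> T j i = 0 ->
  normc (T i j) ^+ 2 <= (1 - normc (T i i) ^+ 2) * (1 - normc (T j j) ^+ 2).
Proof.
move=> Tc ij Tji; have := contraction_diag i Tc.
set a := T i i; set b := T i j; set d := T j j => a1.
have key al be : normc (a * al + b * be) ^+ 2 + normc d ^+ 2 * normc be ^+ 2
    <= normc al ^+ 2 + normc be ^+ 2.
  have := contraction_pair al be Tc ij.
  by rewrite Tji mul0r add0r normcM exprMn.
(* If $|a|=1$, the test vector $(\bar a,\bar b)$ gives $(1+|b|^2)^2\le 1+|b|^2$, which forces
   $b=0$. *)
have [a2|a2] := eqVneq (normc a ^+ 2) 1.
  have := key a^* b^*; rewrite !mul_conjC_normc -rmorphD !normc_real !normc_conj a2.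
  rewrite real_normK ?num_real //= subrr mul0r.
  have := sqr_ge0 (normc d); have := sqr_ge0 (normc b).
  move: (normc b ^+ 2) (normc d ^+ 2) => B D; nra.
(* If $|a|<1$, the first row sends the test vector $(\bar ab,\,1-|a|^2)$ to $b$, and the resulting
   inequality can be divided by $1-|a|^2$. *)
have := key (a^* * b) (1 - normc a ^+ 2)%:C%C.
have -> : a * (a^* * b) + b * (1 - normc a ^+ 2)%:C%C = b.
  rewrite mulrA mul_conjC_normc rmorphB rmorph1; ring.
rewrite normc_real real_normK ?num_real // normcM normc_conj exprMn.
have : 0 < 1 - normc a ^+ 2 by rewrite subr_gt0 lt_neqAle a2.
move: (normc a ^+ 2) (normc b ^+ 2) (normc d ^+ 2) => A B D d0 H.
rewrite -(ler_pM2l d0); nra.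
Qed.

End Contractions.

(** * Schur's test with the weights $u$ and $v$ *)

Section SchurTest.
Variables (F : rcfType) (n : nat) (A : 'M[F]_n) (u v : 'cV[F]_n).
Hypothesis A_ge0 : forall i j, 0 <= A i j.
Hypothesis Av : A *m v = v.
Hypothesis uA : u^T *m A = u^T.
Hypothesis u_gt0 : forall i, 0 < u i 0.
Hypothesis v_gt0 : forall i, 0 < v i 0.

(** For each row the weights $A_{ij}v_j/v_i$ sum to 1, so Jensen's inequality applies to the values
    $y_j/v_j$. Summing against $u_i$ and using $u^TA=u^T$ finishes. *)
Lemma schur_test (y : 'I_n -> F) :
  \sum_i u i 0 / v i 0 * (\sum_j A i j * y j) ^+ 2 <= \sum_j u j 0 / v j 0 * y j ^+ 2.
Proof.
have rowA i : \sum_j A i j * v j 0 = v i 0 by rewrite -[in RHS]Av mxE.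
have colA j : \sum_i u i 0 * A i j = u j 0.
  have := congr1 (fun M : 'rV_n => M 0 j) uA; rewrite !mxE => <-.
  by apply: eq_bigr => i _; rewrite mxE.
have jensen i : (\sum_j A i j * y j) ^+ 2 / v i 0 <= \sum_j A i j * (y j ^+ 2 / v j 0).
  (* [t] is the weighted mean of $y_j/v_j$, and Jensen's inequality is the nonnegativity of the
     variance around it. *)
  set S := \sum_j A i j * y j; pose t := S / v i 0.
  have : 0 <= \sum_j A i j * ((y j - t * v j 0) ^+ 2 / v j 0).
    by rewrite sumr_ge0 // => j _; rewrite mulr_ge0 // divr_ge0 ?sqr_ge0 // ltW.
  under eq_bigr => j _.
    have -> : A i j * ((y j - t * v j 0) ^+ 2 / v j 0) =
       A i j * (y j ^+ 2 / v j 0) - (2%:R * t * (A i j * y j) - t ^+ 2 * (A i j * v j 0)).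
      by field; rewrite gt_eqF.
    over.
  rewrite sumrB sumrB -!mulr_sumr rowA -/S subr_ge0.
  congr (_ <= _); rewrite /t; field; by rewrite gt_eqF.
apply: (@le_trans _ _ (\sum_i u i 0 * \sum_j A i j * (y j ^+ 2 / v j 0))).
  apply: ler_sum => i _; rewrite -mulrA [_^-1 * _]mulrC.
  by rewrite ler_wpM2l ?jensen // ltW.
under eq_bigr do rewrite mulr_sumr.
rewrite exchange_big /= le_eqVlt; apply/orP; left; apply/eqP; apply: eq_bigr => j _.
rewrite -[in RHS]colA !mulr_suml; apply: eq_bigr => i _; ring.
Qed.

(** Scaling by $f=\sqrt{u/v}$ turns the weighted norm of [schur_test] into the standard one. Complex
    vectors reduce to their moduli because $A$ is nonnegative. *)
Lemma contraction_conj (f : 'I_n -> F) :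
  (forall i, 0 < f i) -> (forall i, f i ^+ 2 = u i 0 / v i 0) ->
  contraction (\matrix_(i, j) (f i * A i j / f j)%:C%C).
Proof.
move=> f0 f2 x; have := schur_test (fun j => normc (x j 0) / f j).
rewrite /l2sq; under [in leRHS]eq_bigr => j _.
  rewrite -f2 exprMn mulrC -mulrA -exprMn mulVf ?gt_eqF // expr1n mulr1; over.
apply: le_trans; apply: ler_sum => i _; rewrite -f2 -exprMn ler_sqr ?nnegrE ?normc_ge0 //.
  rewrite mxE; apply: le_trans (normc_sum _ _ _) _; rewrite mulr_sumr.
  apply: ler_sum => j _; rewrite mxE normcM normc_real ger0_norm.
    by rewrite le_eqVlt; apply/orP; left; apply/eqP; ring.
  by rewrite divr_ge0 ?mulr_ge0 // ltW.
rewrite mulr_ge0 ?sumr_ge0 // => [|j _]; first exact: ltW.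
by rewrite mulr_ge0 // divr_ge0 ?normc_ge0 // ltW.
Qed.

End SchurTest.

Lemma char_poly_conj (K : fieldType) n (Q M N : 'M[K]_n) :
  Q \in unitmx -> Q *m M = N *m Q -> char_poly M = char_poly N.
Proof.
move=> Qu QM.
have Qdet : \det (map_mx polyC Q) != 0.
  by rewrite det_map_mx polyC_eq0 -unitfE -unitmxE.
apply: (mulfI Qdet); rewrite /char_poly [RHS]mulrC -!det_mulmx; congr (\det _).
by rewrite mulmxBr mulmxBl scalar_mxC -!map_mxM QM.
Qed.

(** * Uniqueness of the fixed vector of an irreducible matrix *)

Section FixedVectors.
Variables (n : nat) (A : 'M[R]_n.+1) (v : 'cV[R]_n.+1).
Hypothesis A_ge0 : nonneg_mx A.
Hypothesis A_irr : irreducible_mx A.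
Hypothesis Av : A *m v = v.
Hypothesis v_gt0 : forall i, 0 < v i 0.

Lemma expmx_ge0 k i j : 0 <= (A ^+ k) i j.
Proof.
elim: k i j => [|k IH] i j; first by rewrite expr0 mxE ler0n.
by rewrite exprS mxE sumr_ge0 // => l _; rewrite mulr_ge0.
Qed.

Lemma expmx_fixed (y : 'cV[R]_n.+1) k : A *m y = y -> A ^+ k *m y = y.
Proof.
by move=> Ay; elim: k => [|k IH]; rewrite ?expr0 ?mul1mx // exprSr -mulmxE -mulmxA Ay.
Qed.

(* Subtract the largest multiple of v that keeps y nonnegative: the difference
   is a nonnegative fixed vector with a zero coordinate. *)
Lemma irreducible_fixed (y : 'cV[R]_n.+1) :
  A *m y = y -> exists c, forall i, y i 0 = c * v i 0.
Proof.
move=> Ay; have [i0 _ min0] :=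
  Order.TotalTheory.arg_minP (fun i => y i 0 / v i 0) (erefl : xpredT (ord0 : 'I_n.+1)).
pose c := y i0 0 / v i0 0; exists c => i.
pose z := y - c *: v.
have zE j : z j 0 = y j 0 - c * v j 0 by rewrite !mxE.
have z0 j : 0 <= z j 0 by rewrite zE subr_ge0 -ler_pdivlMr // min0.
have Az k : A ^+ k *m z = z.
  by apply: expmx_fixed; rewrite mulmxBr -scalemxAr Av Ay.
(* Since $z_{i_0}=0$, row $i_0$ of $A^kz=z$ is a vanishing sum of nonnegative terms; its term with
   $(A^k)_{i_0i}>0$ forces $z_i=0$. *)
have [k [_ Ak]] := A_irr i0 i.
have := congr1 (fun x : 'cV_n.+1 => x i0 0) (Az k); rewrite !mxE.
rewrite /c divfK ?gt_eqF // subrr => /eqP.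
rewrite psumr_eq0 => [|j _]; last by rewrite mulr_ge0 ?expmx_ge0.
move/allP => /(_ i (mem_index_enum _)) /=; rewrite mulf_eq0 gt_eqF //= zE subr_eq0.
by move/eqP.
Qed.

Lemma ReImD (z t : R[i]) : (complex.Re (z + t) = complex.Re z + complex.Re t) *
  (complex.Im (z + t) = complex.Im z + complex.Im t).
Proof. by case: z; case: t. Qed.

(** As $A$ is real, the real and imaginary parts of $x$ are themselves fixed. *)
Lemma irreducible_fixed_complex (x : 'cV[R[i]]_n.+1) :
  map_mx (real_complex R) A *m x = x -> exists c, forall i, x i 0 = c * (v i 0)%:C%C.
Proof.
move=> Ax.
have [|a Ha] := @irreducible_fixed (map_mx (@complex.Re R) x).
  apply/matrixP => i j; rewrite (ord1 j) {j} -[in RHS]Ax !mxE.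
  rewrite (big_morph (@complex.Re R) (id1 := 0) (op1 := +%R)) //; last first.
    by move=> z t; rewrite ReImD.
  by apply: eq_bigr => j _; rewrite !mxE; case: (x j 0) => s t /=; rewrite mul0r subr0.
have [|b Hb] := @irreducible_fixed (map_mx (@complex.Im R) x).
  apply/matrixP => i j; rewrite (ord1 j) {j} -[in RHS]Ax !mxE.
  rewrite (big_morph (@complex.Im R) (id1 := 0) (op1 := +%R)) //; last first.
    by move=> z t; rewrite ReImD.
  by apply: eq_bigr => j _; rewrite !mxE; case: (x j 0) => s t /=; rewrite mul0r addr0.
exists (Complex a b) => i; have := Ha i; have := Hb i; rewrite !mxE.
by case: (x i 0) => s t /= -> ->; simpc.
Qed.

End FixedVectors.

(** * Symmetrization and Schur triangularization *)

Section SpectralForm.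
Variables (n : nat) (A : 'M[R]_n.+1) (u v : 'cV[R]_n.+1).
Hypothesis A_ge0 : nonneg_mx A.
Hypothesis A_irr : irreducible_mx A.
Hypothesis A_lazy : half_lazy A.
Hypothesis Av : A *m v = v.
Hypothesis uA : u^T *m A = u^T.
Hypothesis u_gt0 : forall i, 0 < u i 0.
Hypothesis v_gt0 : forall i, 0 < v i 0.
Hypothesis uv1 : \sum_i u i 0 * v i 0 = 1.

Definition sym_scale i : R := Num.sqrt (u i 0 / v i 0).
Definition sym_fixed i : R := sym_scale i * v i 0.
Definition sym_mx : 'M[R[i]]_n.+1 :=
  \matrix_(i, j) (sym_scale i * A i j / sym_scale j)%:C%C.

Local Notation f := sym_scale.
Local Notation w := sym_fixed.

Lemma sym_scale_gt0 i : 0 < f i.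
Proof. by rewrite sqrtr_gt0 divr_gt0. Qed.

Lemma sqr_sym_scale i : f i ^+ 2 = u i 0 / v i 0.
Proof. by rewrite sqr_sqrtr // divr_ge0 // ltW. Qed.

Lemma sqr_sym_fixed i : w i ^+ 2 = u i 0 * v i 0.
Proof. by rewrite exprMn sqr_sym_scale; field; rewrite gt_eqF. Qed.

Lemma sym_scaleC_neq0 i : (f i)%:C%C != 0.
Proof. by rewrite -[0]/(0%:C%C) (inj_eq (@complexI R)) gt_eqF ?sym_scale_gt0. Qed.

Lemma sym_diag_unit : diag_mx (\row_i (f i)%:C%C) \in unitmx.
Proof.
rewrite unitmxE det_diag unitfE; apply/prodf_neq0 => i _.
by rewrite mxE sym_scaleC_neq0.
Qed.

Lemma sym_mxE : diag_mx (\row_i (f i)%:C%C) *m map_mx (real_complex R) A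
  = sym_mx *m diag_mx (\row_i (f i)%:C%C).
Proof.
apply/matrixP => i j; rewrite mul_diag_mx mul_mx_diag !mxE -!rmorphM.
by congr (_%:C%C); field; rewrite gt_eqF ?sym_scale_gt0.
Qed.

Lemma contraction_sym_mx : contraction sym_mx.
Proof.
exact: (contraction_conj A_ge0 Av uA u_gt0 v_gt0 sym_scale_gt0 sqr_sym_scale).
Qed.

(** Laziness makes $2A-1$ nonnegative, and it fixes the same $u$ and $v$, so Schur's test applies to
    it as well. *)
Lemma contraction_lazy_sym_mx : contraction (sym_mx *+ 2 - 1%:M).
Proof.
have -> : sym_mx *+ 2 - 1%:M =
    \matrix_(i, j) (f i * ((A *+ 2 - 1%:M) i j) / f j)%:C%C.
  apply/matrixP => i j; rewrite !mxE.
  have [<-|ij] := eqVneq i j.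
    have -> : f i * (A i i *+ 2 - 1) / f i = (f i * A i i / f i) *+ 2 - 1.
      by field; rewrite gt_eqF ?sym_scale_gt0.
    by rewrite rmorphB rmorphMn rmorph1.
  have -> : f i * (A i j *+ 2 - 0) / f j = (f i * A i j / f j) *+ 2.
    by field; rewrite gt_eqF ?sym_scale_gt0.
  by rewrite rmorphMn subr0.
apply: (contraction_conj _ _ _ u_gt0 v_gt0 sym_scale_gt0 sqr_sym_scale).
- move=> i j; rewrite !mxE; have [<-|ij] := eqVneq i j.
    by rewrite /=; have := A_lazy i; lra.
  by rewrite subr0 addr_ge0.
- by rewrite mulmxBl mulr2n mulmxDl Av mul1mx addrK.
- by rewrite mulmxBr mulr2n mulmxDr uA mulmx1 addrK.
Qed.

(** Collects what the norm bound needs. The index [p] carries the eigenvalue 1; by the last clause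
    its spectral projector is $ww^T$, the conjugate of $vu^T$. *)
Lemma spectral_form : exists (P T : 'M[R[i]]_n.+1) (p : 'I_n.+1),
  [/\ P \is unitarymx, is_trig_mx T & sym_mx = P^t* *m T *m P] /\
  [/\ contraction T, T p p = 1, forall i, i != p -> T i p = 0 /\ T p i = 0,
      (forall i, i != p -> T i i != 1) &
      forall i, normc (T i i) ^+ 2 <= complex.Re (T i i)] /\
  char_polyC A = \prod_i ('X - (T i i)%:P) /\
  forall i j, (P p i)^* * P p j = (w i * w j)%:C%C.
Proof.
have [P PU] := Schur sym_mx (ltn0Sn n).
rewrite /similar_to /= conjymx //; move TE: (P *m _ *m _) => T Ttrig.
have /unitarymxP PP := PU; have PP' := mulmx1C PP.
have ET : sym_mx = P^t* *m T *m P.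
  by rewrite -TE !mulmxA PP' mul1mx -mulmxA PP' mulmx1.
have EP : sym_mx *m P^t* = P^t* *m T by rewrite ET -[RHS]mulmx1 -PP !mulmxA.
have PE : P *m sym_mx = T *m P by rewrite -TE -[LHS]mulmx1 -PP' !mulmxA.
have charT : char_polyC A = \prod_i ('X - (T i i)%:P).
  transitivity (char_poly T); last exact: char_poly_trig.
  apply: (@char_poly_conj _ _ (P *m diag_mx (\row_i (f i)%:C%C))).
    by rewrite unitmx_mul unitarymx_unit // sym_diag_unit.
  by rewrite -mulmxA sym_mxE mulmxA PE mulmxA.
have Tc : contraction T by rewrite -TE; apply: contraction_unitary contraction_sym_mx.
(* When $|T_{pp}|=1$ the bound of [contraction_offdiag] is zero, so triangularity and this bound
   clear row and column $p$ off the diagonal. *)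
have T1 p i : T p p = 1 -> i != p -> T i p = 0 /\ T p i = 0.
  move=> Tp ip.
  have np : 1 - normc (T p p) ^+ 2 = 0 by rewrite Tp normc1 expr1n subrr.
  have z0 (z : R[i]) : normc z ^+ 2 <= 0 -> z = 0.
    by rewrite le_eqVlt ltNge sqr_ge0 orbF sqrf_eq0 normc_eq0 => /eqP.
  have /is_trig_mxP Tt := Ttrig.
  have [lt|gt|/val_inj e] := ltngtP i p; last by rewrite e eqxx in ip.
    split; first exact: Tt.
    apply: z0; have := contraction_offdiag Tc _ (Tt _ _ lt).
    by rewrite np mul0r => -> //; rewrite eq_sym.
  split; last exact: Tt.
  by apply: z0; have := contraction_offdiag Tc ip (Tt _ _ gt); rewrite np mulr0.
(* Column $p$ of $P^*$ is fixed by [sym_mx]; divided by $f$ it is fixed by $A$, hence a multiple of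
   $v$. *)
have fixedP p : T p p = 1 -> exists c, forall i, (P p i)^* = c * (w i)%:C%C.
  move=> Tp; pose x : 'cV[R[i]]_n.+1 := \col_i ((P p i)^* / (f i)%:C%C).
  have fx : diag_mx (\row_i (f i)%:C%C) *m x = col p (P^t*).
    by apply/matrixP => i j; rewrite mul_diag_mx !mxE mulrC divfK ?sym_scaleC_neq0.
  have [|c xc] := irreducible_fixed_complex A_ge0 A_irr Av v_gt0 (x := x).
    apply: (row_full_inj (A := diag_mx (\row_i (f i)%:C%C))).
      by rewrite row_full_unit sym_diag_unit.
    rewrite mulmxA sym_mxE -mulmxA fx colE mulmxA EP -mulmxA -(colE p T); congr (_ *m _).
    apply/matrixP => i j; rewrite !mxE (ord1 j) eqxx andbT.
    by have [->|/(T1 _ _ Tp)[]] := eqVneq i p.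
  exists c => i; have := xc i; rewrite mxE => /(canRL (divfK (sym_scaleC_neq0 i))) ->.
  by rewrite /w rmorphM -mulrA [_ * (f i)%:C%C]mulrC.
have dotP p q : \sum_i P p i * (P q i)^* = (p == q)%:R.
  have := congr1 (fun M : 'M_n.+1 => M p q) PP; rewrite !mxE => <-.
  by apply: eq_bigr => i _; rewrite !mxE.
have sumw : \sum_i (w i * w i)%:C%C = 1.
  by rewrite -rmorph_sum -(rmorph1 (real_complex R)) -uv1; congr (_%:C%C);
    apply: eq_bigr => i _; rewrite -expr2 sqr_sym_fixed.
have dotc p q c d : (forall i, (P p i)^* = c * (w i)%:C%C) ->
    (forall i, (P q i)^* = d * (w i)%:C%C) -> c^* * d = (p == q)%:R.
  move=> Hc Hd; rewrite -dotP -[LHS]mulr1 -sumw mulr_sumr; apply: eq_bigr => i _.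
  rewrite -[P p i]conjCK Hc Hd conj_mul_real.
  by rewrite [(w i * w i)%:C%C]rmorphM; ring.
have [p Tp] : exists p, T p p = 1.
  have : root (char_polyC A) 1.
    rewrite /char_polyC -eigenvalue_root_char; apply/eigenvalueP.
    exists (map_mx (real_complex R) u^T).
      by rewrite scale1r -[RHS](congr1 (map_mx (real_complex R)) uA) map_mxM.
    apply/eqP => /matrixP/(_ 0 ord0); rewrite !mxE => /complexI/eqP.
    by rewrite gt_eqF.
  rewrite charT -(big_map (fun i => T i i) predT (fun x => 'X - x%:P)) root_prod_XsubC.
  by case/mapP => p _ Tp; exists p.
exists P, T, p; split=> //; split; last split=> //.
  split=> // [i|i ip|i].
  - exact: T1.
  (* A second diagonal entry 1 would give two orthonormal rows of $P$ that are both multiples of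
     $w$. *)
  - apply/eqP => Ti; have [c Hc] := fixedP _ Tp; have [d Hd] := fixedP _ Ti.
    have := dotc _ _ _ _ Hc Hd; rewrite eq_sym (negbTE ip) => /eqP.
    have := dotc _ _ _ _ Hc Hc; have := dotc _ _ _ _ Hd Hd; rewrite !eqxx.
    move=> dd cc; rewrite mulf_eq0 => /orP[] /eqP e0.
      by move: cc; rewrite e0 mul0r => /eqP; rewrite eq_sym oner_eq0.
    by move: dd; rewrite e0 mulr0 => /eqP; rewrite eq_sym oner_eq0.
  (* The diagonal entries of this contraction are $2T_{ii}-1$, and $|2z-1|\le1$ is equivalent to
     $|z|^2\le\operatorname{Re}z$. *)
  - have TLc : contraction (P *m (sym_mx *+ 2 - 1%:M) *m P^t*).
      by apply: contraction_unitary contraction_lazy_sym_mx.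
    have := contraction_diag i TLc.
    have -> : P *m (sym_mx *+ 2 - 1%:M) *m P^t* = T *+ 2 - 1%:M.
      by rewrite mulmxBr mulmxBl mulmx1 PP !mulr2n mulmxDr mulmxDl TE.
    rewrite !mxE eqxx !sqr_normc_ReIm; case: (T i i) => s t /=; nra.
move=> i j; have [c Hc] := fixedP _ Tp; rewrite -[P p j]conjCK !Hc conj_mul_real.
rewrite [(w i * w j)%:C%C]rmorphM.
have := dotc _ _ _ _ Hc Hc; rewrite eqxx => cc.
by rewrite mulrACA [c * _]mulrC cc mul1r.
Qed.

End SpectralForm.

(** * Unitary conjugation and removal of the eigenvalue 1 *)

Lemma unitary_normc_le1 m (P : 'M[R[i]]_m) i j : P \is unitarymx -> normc (P i j) <= 1.
Proof.
move=> /unitarymxP PP; rewrite -(@expr_le1 _ 2) ?normc_ge0 //.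
have := congr1 (fun M : 'M_m => M i i) PP; rewrite !mxE eqxx.
under eq_bigr do rewrite !mxE mul_conjC_normc.
rewrite -rmorph_sum -(rmorph1 (real_complex R)) => /complexI <-.
by rewrite (bigD1 j) //= lerDl sumr_ge0 // => l _; rewrite sqr_ge0.
Qed.

Lemma normc_unitary_conj_le m (P M : 'M[R[i]]_m) (B : R) i j : P \is unitarymx ->
  (forall a b, normc (M a b) <= B) -> normc ((P^t* *m M *m P) i j) <= m%:R ^+ 2 * B.
Proof.
move=> PU MB; rewrite mxE; apply: le_trans (normc_sum _ _ _) _.
rewrite expr2 -mulrA mulr_natl -[X in _ *+ X]card_ord -sumr_const; apply: ler_sum => b _.
rewrite normcM; apply: (@le_trans _ _ (normc ((P^t* *m M) i b))).
  by rewrite ler_piMr ?normc_ge0 ?unitary_normc_le1.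
rewrite mxE; apply: le_trans (normc_sum _ _ _) _.
rewrite mulr_natl -[X in _ *+ X]card_ord -sumr_const; apply: ler_sum => a _.
rewrite normcM; apply: le_trans (MB a b).
by rewrite ler_piMl ?normc_ge0 // !mxE normc_conj unitary_normc_le1.
Qed.

(** The idempotent $D=$ [delta_mx p p] satisfies $TD=DT=D$, so the cross terms collapse. The
    exponent must be positive: at exponent 0 the two sides would be $1$ and $1-D$. *)
Lemma exp_sub_delta (K : fieldType) m (T : 'M[K]_m.+1) p k :
  T p p = 1 -> (forall i, i != p -> T i p = 0 /\ T p i = 0) ->
  (T - delta_mx p p) ^+ k.+1 = T ^+ k.+1 - delta_mx p p.
Proof.
move=> Tp T0; set D := delta_mx p p.
have TD : T * D = D.
  apply/matrixP => i j; rewrite !mxE (bigD1 p) //= big1 => [|l lp].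
    rewrite !mxE eqxx addr0 /=; have [->|/T0[-> _]] := eqVneq i p; first by rewrite Tp mul1r.
    by rewrite mul0r.
  by rewrite !mxE (negbTE lp) mulr0.
have DT : D * T = D.
  apply/matrixP => i j; rewrite !mxE (bigD1 p) //= big1 => [|l lp].
    rewrite !mxE eqxx andbT addr0 /=; have [->|/T0[_ ->]] := eqVneq j p.
      by rewrite Tp mulr1 andbT.
    by rewrite mulr0 andbF.
  by rewrite !mxE (negbTE lp) andbF mul0r.
have DD : D * D = D by rewrite -mulmxE mul_delta_mx.
have TkD l : T ^+ l * D = D.
  by elim: l => [|l IH]; rewrite ?expr0 ?mul1r // exprSr -mulrA TD.
elim: k => [|k IH]; first by rewrite !expr1.
by rewrite exprSr IH mulrBl !mulrBr TkD DT DD subrr subr0 -exprSr.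
Qed.

Lemma exp_conj (K : pzRingType) (P Q T : K) k :
  P * Q = 1 -> Q * P = 1 -> (Q * T * P) ^+ k = Q * T ^+ k * P.
Proof.
move=> PQ QP; elim: k => [|k IH]; first by rewrite !expr0 mulr1 QP.
by rewrite exprS IH exprS !mulrA -[_ * P * Q]mulrA PQ mulr1.
Qed.

(** * The spectral gap and the entrywise bound on $A^k-vu^T$ *)

Section MixingBound.
Variables (n : nat) (A : 'M[R]_n.+1) (u v : 'cV[R]_n.+1).
Hypothesis A_ge0 : nonneg_mx A.
Hypothesis A_irr : irreducible_mx A.
Hypothesis A_lazy : half_lazy A.
Hypothesis Av : A *m v = v.
Hypothesis uA : u^T *m A = u^T.
Hypothesis u_gt0 : forall i, 0 < u i 0.
Hypothesis v_gt0 : forall i, 0 < v i 0.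
Hypothesis uv1 : \sum_i u i 0 * v i 0 = 1.

Local Notation f := (sym_scale u v).
Local Notation w := (sym_fixed u v).
Local Notation g := (spectral_gap A).

Lemma exp_sym_mx k i j : (sym_mx A u v ^+ k) i j = (f i * (A ^+ k) i j / f j)%:C%C.
Proof.
have f0 l : f l != 0 by rewrite gt_eqF ?sym_scale_gt0.
elim: k i j => [|k IH] i j.
  rewrite !expr0 !mxE; have [->|_] := eqVneq i j; first by rewrite mulr1 divff // rmorph1.
  by rewrite mulr0 mul0r rmorph0.
rewrite !exprS !mxE mulr_sumr mulr_suml rmorph_sum; apply: eq_bigr => l _.
by rewrite IH mxE -rmorphM; congr (_%:C%C); field; rewrite !f0.
Qed.

Lemma other_eigenvalueE (T : 'M[R[i]]_n.+1) p :
  char_polyC A = \prod_i ('X - (T i i)%:P) -> T p p = 1 ->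
  (forall i, i != p -> T i i != 1) ->
  forall z, other_eigenvalue A z <-> exists2 i, i != p & z = T i i.
Proof.
move=> charT Tp T1 z.
pose q := \prod_(i | i != p) ('X - (T i i)%:P).
have charq : char_polyC A = ('X - 1%:P) * q by rewrite charT (bigD1 p) //= Tp.
have rootq y : root q y = [exists i, (i != p) && (y == T i i)].
  rewrite /q rootE (big_morph (fun r => r.[y]) (id1 := 1) (op1 := *%R)); last 2 first.
  - by move=> r s; rewrite hornerM.
  - by rewrite hornerC.
  apply/idP/existsP => [/prodf_eq0[i ip]|[i /andP[ip /eqP ->]]].
    by rewrite !hornerE subr_eq0 => yi; exists i; rewrite ip.
  by apply/prodf_eq0; exists i => //; rewrite !hornerE subrr.
split=> [[zroot zne]|[i ip ->]].
  suff : root q z by rewrite rootq => /existsP[i /andP[ip /eqP ->]]; exists i.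
  case: zne => [zne|mup1].
    by move: zroot; rewrite charq rootM root_XsubC => /orP[/eqP|].
  (* No other diagonal entry is 1, so 1 is a simple root and the multiplicity clause cannot hold. *)
  move: mup1; rewrite charq mupMl ?rootq; last first.
    by apply/existsP => -[i /andP[ip]]; rewrite eq_sym (negbTE (T1 i ip)).
  by rewrite -['X - _]expr1 mup_XsubCX eqxx.
split; last by left; apply/eqP/T1.
by rewrite charq rootM rootq; apply/orP; right; apply/existsP; exists i; rewrite ip /=.
Qed.

(** From $|z|^2\le\operatorname{Re}z$ one gets $\operatorname{Re}z\ge0$, and also
    $\operatorname{Re}z<1$ unless $z=1$; with finitely many eigenvalues the supremum stays below
    1. *)
Lemma spectral_gap_bounds (T : 'M[R[i]]_n.+1) p :
  char_polyC A = \prod_i ('X - (T i i)%:P) -> T p p = 1 ->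
  (forall i, i != p -> T i i != 1) ->
  (forall i, normc (T i i) ^+ 2 <= complex.Re (T i i)) ->
  0 < g <= 1 /\ forall i, i != p -> complex.Re (T i i) <= 1 - g.
Proof.
move=> charT Tp T1 Tre; have oE := other_eigenvalueE charT Tp T1.
have Re_lt1 i : i != p -> complex.Re (T i i) < 1.
  move=> /T1; have := Tre i; rewrite sqr_normc_ReIm; case: (T i i) => s t /= st.
  rewrite ltNge; apply: contra => s1; rewrite eq_complex /=.
  by apply/andP; split; apply/eqP; nra.
have Re_ge0 i : 0 <= complex.Re (T i i) by apply: le_trans (Tre i); rewrite sqr_ge0.
rewrite /spectral_gap; set S := [set _ | _ in _]%classic.
have SE i : i != p -> S (complex.Re (T i i)).
  by move=> ip; exists (T i i) => //; apply/oE; exists i.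
pose m := \big[Num.max/0]_(i | i != p) complex.Re (T i i).
have mub : ubound S m.
  by move=> _ [z /oE[i ip ->] <-]; rewrite /m; apply: le_bigmax_cond.
have m1 : m < 1 by apply: bigmax_lt => // i ip; apply: Re_lt1.
have supub i : i != p -> complex.Re (T i i) <= sup S.
  by move=> ip; apply: ub_le_sup; [exists m | apply: SE].
have [sup0 sup1] : 0 <= sup S /\ sup S < 1.
  (* For a $1\times1$ matrix there is no other eigenvalue; the supremum of the empty set is 0 by
     default, so the gap is 1. *)
  have [->|/set0P[x Sx]] := eqVneq S set0; first by rewrite sup0.
  split; last by apply: le_lt_trans m1; apply: ge_sup => //; exists x.
  case: (Sx) => z /oE[i ip zE] _; apply: le_trans (supub i ip); exact: Re_ge0.
split=> [|i ip]; first by rewrite subr_gt0 sup1 gerBl.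
by rewrite opprB addrC subrK supub.
Qed.

Lemma expmx_mixing_le k i j :
  f i * `|(A ^+ k.+1) i j - v i 0 * u j 0| / f j
    <= n.+1%:R ^+ 2 * (5%:R ^+ n * (1 - g / 4%:R) ^+ k.+1).
Proof.
have [P [T [p [[PU Ttrig ET] [[Tc Tp T0 T1 Tre] [charT Pp]]]]]] :=
  spectral_form A_ge0 A_irr A_lazy Av uA u_gt0 v_gt0 uv1.
have [/andP[g0 g1] gT] := spectral_gap_bounds charT Tp T1 Tre.
have f0 l : 0 < f l by apply: sym_scale_gt0.
pose T' := T - delta_mx p p.
have bound a b : normc ((T' ^+ k.+1) a b) <= 5%:R ^+ n * (1 - g / 4%:R) ^+ k.+1.
  (* The value 1 at [p] is the defect $\sqrt{1-|T'_{pp}|^2}$, as $T'_{pp}=0$. *)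
  pose d (i : 'I_n.+1) : R := if i == p then 1 else Num.sqrt (1 - normc (T i i) ^+ 2).
  have T2 l : l != p -> normc (T l l) ^+ 2 <= 1 - g.
    by move=> lp; apply: le_trans (Tre l) (gT l lp).
  have d0 l : 0 < d l.
    rewrite /d; case: eqVneq => // lp; rewrite sqrtr_gt0; have := T2 l lp; lra.
  apply: (@trig_expmx_le _ _ T' d) => //.
  - have /is_trig_mxP Tt := Ttrig; apply/is_trig_mxP => l m lm; rewrite !mxE Tt //.
    case: eqVneq => [lp|]; last by rewrite subr0.
    by case: eqVneq => [mp|]; [rewrite lp mp ltnn in lm | rewrite subr0].
  - move=> l m lm; rewrite !mxE.
    have -> : (l == p) && (m == p) = false.
      by apply/andP => -[/eqP lp /eqP mp]; rewrite lp mp eqxx in lm.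
    rewrite subr0; have d00 x : 0 <= d x by apply: ltW.
    rewrite /d; have [lp|lp] := eqVneq l p.
      rewrite lp in lm *; have [_ ->] := T0 m (introN eqP (fun e => elimN eqP lm (esym e))).
      by rewrite normc0 mulr_ge0 //; apply: d00.
    have [mp|mp] := eqVneq m p.
      rewrite mp in lm *; have [-> _] := T0 l lp.
      by rewrite normc0 mulr1 sqrtr_ge0.
    rewrite -sqrtrM; last by have := T2 l lp; lra.
    have lt2 : normc (T l m) ^+ 2 <= (1 - normc (T l l) ^+ 2) * (1 - normc (T m m) ^+ 2).
      have /is_trig_mxP Tt := Ttrig.
      have [lm'|ml|/val_inj e] := ltngtP l m; last by rewrite e eqxx in lm.
        rewrite Tt // normc0 expr0n /= mulr_ge0 //.
          by have := T2 l lp; lra.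
        by have := T2 m mp; lra.
      exact: contraction_offdiag Tc lm (Tt _ _ ml).
    by rewrite -[X in X <= _](ger0_norm (normc_ge0 _)) -sqrtr_sqr ler_wsqrtr.
  - move=> l; rewrite !mxE /d; have [->|lp] := eqVneq l p.
      by rewrite Tp subrr normc0 expr1n; lra.
    rewrite subr0; have := T2 l lp; have := normc_ge0 (T l l).
    move: (normc (T l l)) => r r0 r2; rewrite sqr_sqrtr; last by lra.
    (* Given $r^2\le1-g$, the inequality $r+\frac{1-r^2}4\le1-\frac g4$ reduces to
       $2(1-r)^2\ge0$. *)
    have : 0 <= (1 - r) ^+ 2 by rewrite sqr_ge0.
    rewrite expr2; nra.
have -> : f i * `|(A ^+ k.+1) i j - v i 0 * u j 0| / f j = normc ((P^t* *m T' ^+ k.+1 *m P) i j).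
  have /unitarymxP PP := PU; have PP' := mulmx1C PP.
  have Ek : P^t* *m T ^+ k.+1 *m P = sym_mx A u v ^+ k.+1.
    by rewrite ET !mulmxE exp_conj.
  have Pd : (P^t* *m delta_mx p p *m P) i j = (w i * w j)%:C%C.
    rewrite -Pp -(mul_delta_mx (0 : 'I_1)) mulmxA -mulmxA -colE -rowE mxE big_ord1.
    by rewrite !mxE.
  have -> : P^t* *m T' ^+ k.+1 *m P = sym_mx A u v ^+ k.+1 - P^t* *m delta_mx p p *m P.
    by rewrite /T' exp_sub_delta // mulmxBr mulmxBl Ek.
  rewrite [in RHS]mxE [X in normc (_ + X)]mxE Pd exp_sym_mx -rmorphB normc_real.
  have -> : w i * w j = f i * (v i 0 * u j 0) / f j.
    have : f j ^+ 2 * v j 0 = u j 0 by rewrite sqr_sym_scale // divfK ?gt_eqF.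
    by move=> <-; rewrite /sym_fixed; field; rewrite gt_eqF.
  rewrite -mulrBl -mulrBr !normrM normfV [ `|f i|]gtr0_norm // [ `|f j|]gtr0_norm //.
exact: normc_unitary_conj_le.
Qed.

End MixingBound.

(** * From the entrywise bound to the mixing time *)

Lemma kappa_le n (u v : 'cV[R]_n.+1) i : kappa u v <= u i 0 * v i 0.
Proof. exact: bigmin_le. Qed.

Lemma kappa_gt0 n (u v : 'cV[R]_n.+1) :
  (forall i, 0 < u i 0) -> (forall i, 0 < v i 0) -> 0 < kappa u v.
Proof.
move=> u0 v0; rewrite /kappa; elim/big_ind: _ => [|x y x0 y0|i _]; rewrite ?mulr_gt0 //.
by rewrite lt_min x0.
Qed.

Lemma mixing_time_le n (A : 'M[R]_n) u v eps k :
  mixes A u v eps k -> (mixing_time A u v eps <= k)%N.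
Proof.
move=> Hk; rewrite /mixing_time; case: pselect => // h.
by case: ex_minnP => m _; apply; apply/asboolP.
Qed.

Section Mixing.
Variables (n : nat) (A : 'M[R]_n.+1) (u v : 'cV[R]_n.+1).
Hypothesis A_ge0 : nonneg_mx A.
Hypothesis A_irr : irreducible_mx A.
Hypothesis A_lazy : half_lazy A.
Hypothesis Av : A *m v = v.
Hypothesis uA : u^T *m A = u^T.
Hypothesis u_gt0 : forall i, 0 < u i 0.
Hypothesis v_gt0 : forall i, 0 < v i 0.
Hypothesis uv1 : \sum_i u i 0 * v i 0 = 1.

Local Notation f := (sym_scale u v).
Local Notation w := (sym_fixed u v).
Local Notation g := (spectral_gap A).

Lemma spectral_gap_itv : 0 < g <= 1.
Proof.
have [P [T [p [_ [[_ Tp _ T1 Tre] [charT _]]]]]] :=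
  spectral_form A_ge0 A_irr A_lazy Av uA u_gt0 v_gt0 uv1.
by have [] := spectral_gap_bounds charT Tp T1 Tre.
Qed.

Lemma uv_le1 i : u i 0 * v i 0 <= 1.
Proof.
by rewrite -uv1 (bigD1 i) //= lerDl sumr_ge0 // => l _; rewrite mulr_ge0 // ltW.
Qed.

(** Since $w_i^2=u_iv_i\le1$, one has $w_i\ge w_i^2\ge\kappa$. *)
Lemma sym_fixed_bounds i : kappa u v <= w i <= 1.
Proof.
have w0 : 0 <= w i by rewrite mulr_ge0 // ltW // sym_scale_gt0.
have w1 : w i <= 1 by rewrite -(@expr_le1 _ 2) // sqr_sym_fixed // uv_le1.
rewrite w1 andbT; apply: le_trans (kappa_le u v i) _.
by rewrite -sqr_sym_fixed // expr2 ler_piMl.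
Qed.

Lemma mixes_of_bound eps k :
  n.+1%:R ^+ 3 * (5%:R ^+ n * (1 - g / 4%:R) ^+ k.+1) <= eps * kappa u v ->
  mixes A u v eps k.+1.
Proof.
set B := 5%:R ^+ n * _ => Beps x x1.
have k0 : 0 < kappa u v by apply: kappa_gt0.
have f0 i : 0 < f i by apply: sym_scale_gt0.
have f_ge0 i : 0 <= f i by apply: ltW.
have u_ge0 i : 0 <= u i 0 by apply: ltW.
have Du (y : 'cV[R]_n.+1) : l1norm (Dmx u *m y) = \sum_i u i 0 * `|y i 0|.
  apply: eq_bigr => i _; rewrite /Dmx mul_diag_mx !mxE normrM ger0_norm //.
rewrite Du; rewrite Du in x1.
pose G := A ^+ k.+1 - v *m u^T.
have GE i j : G i j = (A ^+ k.+1) i j - v i 0 * u j 0.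
  by rewrite /G !mxE big_ord1 !mxE.
(* Writing $u=wf$, the bounds on $w$ give $u_i\le f_i$ and $f_j\le u_j/\kappa$: passing from the
   weights $f$ to $u$ costs one factor $1/\kappa$. Summing over $i$ later adds the third factor
   $n+1$. *)
have Gle i j : u i 0 * `|G i j| <= n.+1%:R ^+ 2 * B / kappa u v * u j 0.
  have := expmx_mixing_le A_ge0 A_irr A_lazy Av uA u_gt0 v_gt0 uv1 k i j.
  rewrite -GE -/B; move: (_ * B) => C H.
  have fE l : u l 0 = w l * f l.
    by rewrite /sym_fixed mulrAC -expr2 sqr_sym_scale // divfK // gt_eqF.
  have [/andP[_ wi1] /andP[kw wj1]] := (sym_fixed_bounds i, sym_fixed_bounds j).
  have C0 : 0 <= C by apply: le_trans H; rewrite divr_ge0 ?mulr_ge0 // ltW.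
  apply: (@le_trans _ _ (C * f j)).
    rewrite -ler_pdivrMr //; apply: le_trans H.
    by rewrite ler_wpM2r ?invr_ge0 ?f_ge0 // ler_wpM2r // fE ler_piMl ?f_ge0.
  rewrite -mulrA ler_wpM2l // mulrC ler_pdivlMr // mulrC fE ler_wpM2r ?f_ge0 //.
apply: (@le_trans _ _ (\sum_(i < n.+1) n.+1%:R ^+ 2 * B / kappa u v)).
  apply: ler_sum => i _; rewrite -[leRHS]mulr1 -[X in _ <= _ * X]x1 mulr_sumr.
  apply: (@le_trans _ _ (u i 0 * \sum_j `|G i j| * `|x j 0|)).
    rewrite ler_wpM2l ?u_ge0 // mxE; apply: le_trans (ler_norm_sum _ _ _) _.
    by apply: ler_sum => j _; rewrite normrM.
  rewrite mulr_sumr; apply: ler_sum => j _.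
  by rewrite mulrA [leRHS]mulrA ler_wpM2r //; apply: Gle.
rewrite sumr_const card_ord -[X in X <= _]mulr_natl mulrA ler_pdivrMr //.
by apply: le_trans Beps; rewrite mulrA -exprS.
Qed.

Lemma mixes_log (eps : R) k : 0 < eps -> eps < 1 ->
  24%:R * (n.+1%:R + ln (1 / (eps * kappa u v))) / g <= k.+1%:R ->
  mixes A u v eps k.+1.
Proof.
move=> e0 e1; set L := ln _ => kL; apply: mixes_of_bound.
have /andP[g0 g1] := spectral_gap_itv.
have k0 : 0 < kappa u v by apply: kappa_gt0.
have k1 : kappa u v <= 1 by apply: le_trans (kappa_le u v ord0) (uv_le1 ord0).
have ek0 : 0 < eps * kappa u v by rewrite mulr_gt0.
have expL : expR (- L) = eps * kappa u v.
  by rewrite expRN /L lnK ?posrE ?divr_gt0 // div1r invrK.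
have L0 : 0 <= L.
  rewrite /L ln_ge0 // div1r invf_ge1 // mulr_ile1 ?(ltW e0) ?(ltW k0) ?(ltW e1) //.
(* Here $24=4\cdot6$: the exponent $g(k+1)/4$ is at least $6(n+1)+6L\ge6(n+1)+L$. *)
have pow : (1 - g / 4%:R) ^+ k.+1 <= expR (- (6%:R * n.+1%:R)) * (eps * kappa u v).
  apply: (@le_trans _ _ (expR (- (g / 4%:R)) ^+ k.+1)).
    by rewrite lerXn2r ?nnegrE ?expR_ge0 ?expR_ge1Dx //; lra.
  rewrite -expL -expRD -expRM_natl ler_expR.
  move: kL; rewrite ler_pdivrMr // => kL.
  nra.
apply: le_trans (_ : n.+1%:R ^+ 3 * (5%:R ^+ n * (expR (- (6%:R * n.+1%:R)) * (eps * kappa u v))) <= _).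
  by rewrite ler_wpM2l ?exprn_ge0 // ler_wpM2l ?exprn_ge0.
set C : R := expR (- _).
have -> : n.+1%:R ^+ 3 * (5%:R ^+ n * (C * (eps * kappa u v)))
  = (n.+1%:R ^+ 3 * 5%:R ^+ n * C) * (eps * kappa u v) by ring.
rewrite -[leRHS]mul1r ler_wpM2r ?(ltW ek0) // /C.
rewrite expRN ler_pdivrMr ?expR_gt0 // mul1r.
(* It remains to absorb $(n+1)^35^n$ into $e^{6(n+1)}$. Three factors $e^{n+1}\ge2^{n+1}\ge n+1$
   cover $(n+1)^3$, and three more cover $5^n\le(2^3)^{n+1}$. *)
have e2 : 2%:R <= expR 1 :> R by have := expR_ge1Dx (1 : R); lra.
have pow2 : 2%:R ^+ n.+1 <= expR 1 ^+ n.+1 :> R.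
  by rewrite lerXn2r ?nnegrE ?expR_ge0.
rewrite expRM_natl -[n.+1%:R in leRHS]mulr1 expRM_natl (exprD _ 3 3).
have nle : n.+1%:R <= expR 1 ^+ n.+1 :> R.
  by apply: le_trans pow2; rewrite -natrX ler_nat ltnW // ltn_expl.
rewrite ler_pM ?exprn_ge0 //.
  by rewrite lerXn2r ?nnegrE ?exprn_ge0 ?expR_ge0.
apply: (@le_trans _ _ ((2%:R ^+ n.+1) ^+ 3)).
  rewrite -exprM mulnC exprM; apply: (@le_trans _ _ (5%:R ^+ n.+1)).
    by rewrite ler_eXn2l ?ltr1n.
  by rewrite lerXn2r ?nnegrE ?exprn_ge0 // -natrX ler_nat.
by rewrite lerXn2r ?nnegrE ?exprn_ge0 ?expR_ge0.
Qed.

End Mixing.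

Theorem theorem1p4 :
  exists c : R, 0 < c /\
  forall (n : nat) (A : 'M[R]_n.+1) (u v : 'cV[R]_n.+1),
    nonneg_mx A -> irreducible_mx A -> half_lazy A ->
    A *m v = v -> u^T *m A = u^T ->
    (forall i, 0 < u i 0) -> (forall i, 0 < v i 0) ->
    \sum_i u i 0 * v i 0 = 1 ->
    forall eps : R, 0 < eps < 1 ->
      (exists tau : nat, mixes A u v eps tau) /\
      (mixing_time A u v eps)%:R <=
        c * (n.+1%:R + ln (1 / (eps * kappa u v))) / spectral_gap A.
Proof.
(* The constant is the 24 of [mixes_log] plus 1 for rounding up to the integer [k.+1], which is
   affordable because $X/g\ge1$. *)
exists 25%:R; split=> // n A u v A0 Airr Alazy Av uA u0 v0 uv1 eps /andP[e0 e1].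
have /andP[g0 g1] := spectral_gap_itv A0 Airr Alazy Av uA u0 v0 uv1.
set X := n.+1%:R + _; set g := spectral_gap A in g0 g1 *.
have X1 : 1 <= X.
  have k0 := kappa_gt0 u0 v0.
  have k1 : kappa u v <= 1 := le_trans (kappa_le u v ord0) (uv_le1 u0 v0 uv1 ord0).
  rewrite -[1]addr0 lerD ?ler1n // ln_ge0 // div1r invf_ge1 ?mulr_gt0 //.
  by rewrite mulr_ile1 ?(ltW e0) ?(ltW k0) ?(ltW e1).
have Xg1 : 1 <= X / g by rewrite ler_pdivlMr // mul1r (le_trans g1).
pose k := Num.truncn (24%:R * X / g).
have K0 : 0 <= 24%:R * X / g by rewrite -mulrA mulr_ge0 // (le_trans ler01).
have /andP[k_le k_gt] := truncn_itv K0.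
have mix : mixes A u v eps k.+1 by apply: mixes_log => //; apply: ltW.
split; first by exists k.+1.
apply: (@le_trans _ _ (k.+1%:R)); first by rewrite ler_nat mixing_time_le.
have {}k_le : k%:R <= 24%:R * (X / g) by rewrite mulrA.
by rewrite -natr1 -mulrA; lra.
Qed.
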